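(* Let $A=\sigma(R)\langle x_1,\dots,x_n\rangle$ be a bijective skew PBW extension of a right Gröbner soluble ring $R$, let $m\ge1$, and fix a monomial order on $\mathrm{Mon}(A^m)$. Let $M\ne0$ be a right submodule of $A^m$ and let $G$ be a finite subset of non-zero generators of $M$. Then the following conditions are equivalent: (i) $G$ is a Gröbner basis of $M$. (ii) For all $F:=\{\mathbf g_1,\dots,\mathbf g_s\}\subseteq G$ with $\mathbf X_F\ne\mathbf 0$, and for any $(b_1,\dots,b_s)\in B_F$, $$\sum_{i=1}^s\mathbf g_i\,\psi^{-1}_{\beta_i,\gamma_i}(b_i)\,x^{\gamma_i}\xrightarrow{G}_+\mathbf 0,$$ where $\mathbf X_F$, $\beta_i$, $\gamma_i$, $B_F$ and $\psi$ are as defined in the context.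
   Context: **Skew PBW extensions.** Rings are associative with $1$. Let $R\subseteq A$ be rings. $A$ is a skew PBW extension of $R$, written $A=\sigma(R)\langle x_1,\dots,x_n\rangle$, if there are $x_1,\dots,x_n\in A$ such that: $A$ is a free left $R$-module with basis $\mathrm{Mon}(A)=\{x^\alpha:=x_1^{\alpha_1}\cdots x_n^{\alpha_n}\mid\alpha\in\mathbb N^n\}$; for every $i$ and $0\ne r\in R$ there is $c_{i,r}\in R\setminus\{0\}$ with $x_ir-c_{i,r}x_i\in R$; for all $i,j$ there is $c_{i,j}\in R\setminus\{0\}$ with $x_jx_i-c_{i,j}x_ix_j\in R+Rx_1+\cdots+Rx_n$. Then there are injective ring endomorphisms $\sigma_i$ of $R$ and $\sigma_i$-derivations $\delta_i$ with $x_ir=\sigma_i(r)x_i+\delta_i(r)$ for all $r\in R$. $A$ is bijective if every $\sigma_i$ is bijective and every $c_{i,j}$ is invertible. Put $|\alpha|=\alpha_1+\cdots+\alpha_n$, $\deg(x^\alpha)=|\alpha|$, $\sigma^\alpha=\sigma_1^{\alpha_1}\cdots\sigma_n^{\alpha_n}$ and $\sigma^{-\alpha}=(\sigma^\alpha)^{-1}$; the degree of a non-zero $f\in A$ is the largest degree of a monomial occurring in it. For $\alpha,\beta\in\mathbb N^n$, $c_{\alpha,\beta}\in R$ is the unique element with $x^\alpha x^\beta=c_{\alpha,\beta}x^{\alpha+\beta}+p_{\alpha,\beta}$, where $p_{\alpha,\beta}=0$ or $\deg p_{\alpha,\beta}<|\alpha+\beta|$ (it is invertible when $A$ is bijective).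 For $\theta_1,\theta_2\in\mathbb N^n$ let $\psi_{\theta_1,\theta_2}:R\to R$ be the automorphism $\psi_{\theta_1,\theta_2}(r)=\sigma^{\theta_1+\theta_2}(\sigma^{-\theta_2}(r))$. **Right Gröbner soluble (RGS) ring.** $R$ is RGS if it is right Noetherian; there is an algorithm which, given $a,r_1,\dots,r_m\in R$, decides whether $a\in r_1R+\cdots+r_mR$ and, if so, finds $b_i\in R$ with $a=\sum r_ib_i$; and there is an algorithm which, given $r_1,\dots,r_m\in R$, finds a finite generating set of the right $R$-module $\mathrm{Syz}^r_R[r_1\cdots r_m]=\{(b_1,\dots,b_m)\in R^m\mid\sum r_ib_i=0\}$. **Monomial orders.** $A^m$ is the free right $A$-module of vectors of length $m$ with canonical basis $\mathbf e_1,\dots,\mathbf e_m$; $\mathrm{Mon}(A^m)$ is the set of vectors $\mathbf X=x^\alpha\mathbf e_i$, with $\mathrm{ind}(\mathbf X)=i$, $\exp(\mathbf X)=\alpha$, $\deg(\mathbf X)=|\alpha|$. A monomial order on $\mathrm{Mon}(A^m)$ is a total order $\succeq$ such that (i) $x^{\beta+\alpha}\mathbf e_i\succeq x^\alpha\mathbf e_i$; (ii) $x^\beta\mathbf e_j\succeq x^\alpha\mathbf e_i$ implies $x^{\gamma+\beta}\mathbf e_j\succeq x^{\gamma+\alpha}\mathbf e_i$ for all $\gamma$; (iii) $\deg\mathbf X>\deg\mathbf Y$ implies $\mathbf X\succ\mathbf Y$. Each $\mathbf f\ne\mathbf 0$ in $A^m$ is uniquely $\mathbf f=c_1\mathbf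 X_1+\cdots+c_k\mathbf X_k$ with $c_i\in R\setminus\{0\}$ and $\mathbf X_1\succ\cdots\succ\mathbf X_k$ monomials; $\mathrm{lm}(\mathbf f)=\mathbf X_1$, $\mathrm{lc}(\mathbf f)=c_1$. By convention $\mathrm{lm}(\mathbf 0)=\mathbf 0$, $\mathrm{lc}(\mathbf 0)=0$, and $\mathbf X\succ\mathbf 0$ for every monomial $\mathbf X$. The least common multiple of monomials of $A^m$ is $\mathbf 0$ if their indices are not all equal, and is $x^\mu\mathbf e_i$ if they all have index $i$, where $\mu$ is the componentwise maximum of their exponents. **Reduction.** For a finite set $F$ of non-zero vectors, $\mathbf f$ reduces to $\mathbf h$ by $F$ in one step, $\mathbf f\xrightarrow{F}\mathbf h$, if there are $\mathbf f_1,\dots,\mathbf f_t\in F$ and $r_1,\dots,r_t\in R$ such that (i) $\mathrm{lm}(\mathbf f_i)\mid\mathrm{lm}(\mathbf f)$, i.e. the indices agree and there is $\alpha_i\in\mathbb N^n$ with $\beta_i+\alpha_i=\exp(\mathrm{lm}(\mathbf f))$, $\beta_i:=\exp(\mathrm{lm}(\mathbf f_i))$; (ii) $\mathrm{lc}(\mathbf f)=\sum_{i=1}^t\mathrm{lc}(\mathbf f_i)\sigma^{\beta_i}(r_i)c_{\beta_i,\alpha_i}$; (iii) $\mathbf h=\mathbf f-\sum_{i=1}^t\mathbf f_ir_ix^{\alpha_i}$. By convention $\mathbf 0\xrightarrow{F}\mathbf 0$. $\mathbf f\xrightarrow{F}_+\mathbf h$ means that $\mathbf h$ is obtained from $\mathbf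 f$ by a finite chain of one-step reductions by $F$. $\mathbf f$ is reduced with respect to $F$ if $\mathbf f=\mathbf 0$ or $\mathbf f$ admits no one-step reduction by $F$; otherwise it is reducible. **Gröbner basis.** For a right submodule $M\ne0$ of $A^m$, a non-empty finite subset $G$ of non-zero vectors of $M$ is a Gröbner basis for $M$ if each $\mathbf 0\ne\mathbf f\in M$ is reducible with respect to $G$. **$\mathbf X_F$ and $B_F$.** For a (non-empty) $F=\{\mathbf g_1,\dots,\mathbf g_s\}$ of non-zero vectors of $A^m$, $\mathbf X_F$ is the least common multiple of $\mathrm{lm}(\mathbf g_1),\dots,\mathrm{lm}(\mathbf g_s)$. When $\mathbf X_F\ne\mathbf 0$, put $\beta_i=\exp(\mathrm{lm}(\mathbf g_i))$ and let $\gamma_i\in\mathbb N^n$ be such that $\gamma_i+\beta_i=\exp(\mathbf X_F)$. $B_F$ denotes a (fixed, for each $F$) finite set of generators in $R^s$ of the right $R$-module $S_F=\mathrm{Syz}^r_R[\mathrm{lc}(\mathbf g_1)c_{\beta_1,\gamma_1}\ \cdots\ \mathrm{lc}(\mathbf g_s)c_{\beta_s,\gamma_s}]$. *)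

(* Defs.v *)
From Stdlib Require Import Relation_Operators.
From HB Require Import structures.
From mathcomp Require Import all_boot all_order all_algebra finmap.
From mathcomp Require Export mpoly.

Set Implicit Arguments.
Unset Strict Implicit.
Unset Printing Implicit Defensive.

Import GRing.Theory.
Local Open Scope fset_scope.
Local Open Scope ring_scope.

Section InverseOfBijection.
Context (T : choiceType) (U : eqType) (f : T -> U) (bij_f : bijective f).

Fact bij_surj (y : U) : exists x, f x == y.
Proof. by case: bij_f => g _ gK; exists (g y); rewrite gK. Qed.

Definition inv_bij (y : U) : T := xchoose (bij_surj y).

Lemma inv_bijKr : cancel inv_bij f.
Proof. by move=> y; apply/eqP; exact: (xchooseP (bij_surj y)). Qed.

Lemma inv_bijK : cancel f inv_bij.
Proof. by move=> x; apply: (bij_inj bij_f); rewrite inv_bijKr. Qed.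

Lemma inv_bij_bij : bijective inv_bij.
Proof. exact: Bijective inv_bijKr inv_bijK. Qed.
End InverseOfBijection.

(* Vectors over a ring S indexed by a finite type I, i.e. {ffun I -> S}, form
   the free right S-module S^I under [rscale]. *)
Section RightModules.
Context (S : nzRingType) (I : finType).
Implicit Types (v : {ffun I -> S}) (M : {ffun I -> S} -> Prop).

Definition rscale v (a : S) : {ffun I -> S} := [ffun i => v i * a].

Definition right_submodule M : Prop :=
  [/\ M 0, forall u v, M u -> M v -> M (u + v) & forall v a, M v -> M (rscale v a)].

Definition generates (G : {fset {ffun I -> S}}) M : Prop :=
  forall v, M v <->
    exists a : {ffun I -> S} -> S, v = \sum_(g <- enum_fset G) rscale g (a g).

Definition syz (r b : {ffun I -> S}) : Prop := \sum_(i : I) r i * b i = 0.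
End RightModules.

Section RightGrobnerSoluble.
Context (R : nzRingType).

Definition right_ideal (J : R -> Prop) : Prop :=
  [/\ J 0, forall a b, J a -> J b -> J (a + b) & forall a b, J a -> J (a * b)].

Definition in_right_ideal (k : nat) (r : {ffun 'I_k -> R}) (a : R) : Prop :=
  exists b : {ffun 'I_k -> R}, a = \sum_(i < k) r i * b i.

Definition right_noetherian : Prop :=
  forall J, right_ideal J ->
    exists (k : nat) (r : {ffun 'I_k -> R}), forall a, J a <-> in_right_ideal r a.

(* The two algorithms are functions of the type theory, given as data;
   [None] is the answer "a is not in r_1 R + ... + r_k R". *)
Record RGS := {
  rgs_noetherian : right_noetherian;
  rgs_solve : forall k : nat, R -> {ffun 'I_k -> R} -> option {ffun 'I_k -> R};
  rgs_solveP : forall (k : nat) (a : R) (r : {ffun 'I_k -> R}),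
    match rgs_solve a r with
    | Some b => a = \sum_(i < k) r i * b i
    | None => ~ in_right_ideal r a
    end;
  rgs_syz : forall k : nat, {ffun 'I_k -> R} -> {fset {ffun 'I_k -> R}};
  rgs_syzP : forall (k : nat) (r : {ffun 'I_k -> R}),
    generates (rgs_syz r) (syz r)
}.
End RightGrobnerSoluble.

(* [mmap emb x p] is the sum of the emb(p_alpha) x^alpha over the exponents
   alpha occurring in p, with x^alpha = [mmap1 x alpha] the ordered product
   x_1^alpha_1 ... x_n^alpha_n.  The multiplication of {mpoly R[n]} is not used:
   {mpoly R[n]} only serves as the left R-module of finitely supported families
   of elements of R indexed by 'X_{1..n}, so that [pbw_basis] says that A is a
   free left R-module with basis the x^alpha. *)
Record skewPBW (n : nat) (R A : nzRingType) := {
  emb : {rmorphism R -> A};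
  emb_inj : injective emb;
  var : 'I_n -> A;
  pbw_basis : bijective (mmap emb var);
  var_scalar : forall (i : 'I_n) (r : R), r != 0 ->
    exists c d : R, c != 0 /\ var i * emb r - emb c * var i = emb d;
  cvar : 'I_n -> 'I_n -> R;
  cvar_neq0 : forall i j : 'I_n, cvar i j != 0;
  var_var : forall i j : 'I_n, exists (d : R) (e : 'I_n -> R),
    var j * var i - emb (cvar i j) * var i * var j
      = emb d + \sum_(k < n) emb (e k) * var k
}.

Section SkewPBW.
Context (n : nat) (R A : nzRingType) (P : skewPBW n R A).
Implicit Types (alpha beta : 'X_{1..n}).

Definition xmon alpha : A := mmap1 (var P) alpha.

Definition coord (f : A) : {mpoly R[n]} := inv_bij (pbw_basis P) f.

(* sigma_i(r) and delta_i(r) are read off the expansion of x_i r, see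
   [var_scalarE]. *)
Definition sigma (i : 'I_n) (r : R) : R := (coord (var P i * emb P r))@_U_(i).
Definition delta (i : 'I_n) (r : R) : R := (coord (var P i * emb P r))@_0.

(* The coefficient of x^(alpha + beta) in x^alpha x^beta, see [xmonM]. *)
Definition cmon alpha beta : R :=
  (coord (xmon alpha * xmon beta))@_(alpha + beta).

Fact mmap_affine (c d : R) (i : 'I_n) :
  mmap (emb P) (var P) (c *: 'X_i + d%:MP) = emb P c * var P i + emb P d.
Proof.
rewrite raddfD /= mmapC; congr (_ + _).
have [-> | c0] := eqVneq c 0; first by rewrite scale0r !raddf0 mul0r.
rewrite /mmap (perm_big [:: U_(i)%MM]) /=; last first.
  apply: uniq_perm => // u; rewrite mcoeff_msupp mcoeffZ mcoeffX inE.
  by rewrite (eq_sym u); case: (_ == u); rewrite ?mulr1 ?mulr0 ?c0 ?eqxx.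
by rewrite big_seq1 mcoeffZ mcoeffX eqxx mulr1 mmap1U.
Qed.

Lemma var_scalarE (i : 'I_n) (r : R) :
  var P i * emb P r = emb P (sigma i r) * var P i + emb P (delta i r).
Proof.
have [c [d e]] : exists c d, var P i * emb P r = emb P c * var P i + emb P d.
  have [->|r0] := eqVneq r 0; first by exists 0, 0; rewrite !raddf0 mulr0 mul0r addr0.
  by have [c [d [_ /eqP]]] := var_scalar P i r0; rewrite subr_eq addrC => /eqP; exists c, d.
rewrite /sigma /delta /coord e -mmap_affine inv_bijK !mcoeffD !mcoeffZ !mcoeffX !mcoeffC.
by rewrite !eqxx ?mnm1_eq0 !mulr1 !mulr0 addr0 add0r mmap_affine.
Qed.

Fact coordE f : mmap (emb P) (var P) (coord f) = f.
Proof. exact: inv_bijKr. Qed.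

Fact coord_mmap p : coord (mmap (emb P) (var P) p) = p.
Proof. exact: inv_bijK. Qed.

Fact coordD f g : coord (f + g) = coord f + coord g.
Proof. by rewrite -[f]coordE -[g]coordE -raddfD !coord_mmap. Qed.

Fact mmap_scale (c : R) p :
  mmap (emb P) (var P) (c *: p) = emb P c * mmap (emb P) (var P) p.
Proof.
have le_cp : (msize (c *: p) <= msize p)%N by exact: msizeZ_le.
rewrite (mmapE (msize p)) // (mmapE (msize p)) // mulr_sumr.
by apply: eq_bigr => u _; rewrite mcoeffZ /= rmorphM mulrA.
Qed.

Fact coordZ c f : coord (emb P c * f) = c *: coord f.
Proof. by rewrite -[f]coordE -mmap_scale !coord_mmap. Qed.

Fact coord_xmon alpha : coord (xmon alpha) = 'X_[alpha].
Proof.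
rewrite -[RHS]coord_mmap; congr coord.
by rewrite /mmap msuppX big_seq1 mcoeffX eqxx rmorph1 mul1r.
Qed.

(* [deg_lt d f]: f = 0 or deg f < d *)
Definition deg_lt (d : nat) (f : A) : Prop := (msize (coord f) <= d)%N.

Fact deg_ltD d f g : deg_lt d f -> deg_lt d g -> deg_lt d (f + g).
Proof.
rewrite /deg_lt coordD => df dg; apply: leq_trans (msizeD_le _ _) _.
by rewrite geq_max df dg.
Qed.

Fact deg_ltZ d c f : deg_lt d f -> deg_lt d (emb P c * f).
Proof. by rewrite /deg_lt coordZ; apply: leq_trans; exact: msizeZ_le. Qed.

Fact deg_ltW d e f : (d <= e)%N -> deg_lt d f -> deg_lt e f.
Proof. by move=> de df; exact: leq_trans df de. Qed.

Fact deg_lt0 d : deg_lt d 0.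
Proof. by rewrite /deg_lt -(raddf0 (mmap (emb P) (var P))) coord_mmap msize0. Qed.

Fact deg_lt_xmon alpha : deg_lt (mdeg alpha).+1 (xmon alpha).
Proof. by rewrite /deg_lt coord_xmon msizeX. Qed.

Fact deg_lt_sum d (I : eqType) (s : seq I) (F : I -> A) :
  (forall i, i \in s -> deg_lt d (F i)) -> deg_lt d (\sum_(i <- s) F i).
Proof.
move=> dF; rewrite big_seq; elim/big_rec: _ => [|i f si df]; first exact: deg_lt0.
by apply: deg_ltD => //; exact: dF.
Qed.

Fact xmon_var (j : 'I_n) alpha : (forall k : 'I_n, (k < j)%N -> alpha k = 0%N) ->
  xmon (U_(j) + alpha)%MM = var P j * xmon alpha.
Proof.
move=> alpha0; rewrite /xmon /mmap1.
have srt : sorted ltn (map val (index_enum 'I_n)).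
  by rewrite [index_enum _]unlock -enumT val_enum_ord iota_ltn_sorted.
case/splitPr: (mem_index_enum j) srt => s1 s2.
rewrite sorted_pairwise; last exact: ltn_trans.
rewrite map_cat pairwise_cat /= => /and3P[/allrelP lt1 _ /andP[/allP lt2 _]].
have {}lt1 k : k \in s1 -> (k < j)%N.
  by move=> ks; apply: lt1; [exact: map_f | rewrite inE eqxx].
have {}lt2 k : k \in s2 -> (j < k)%N by move=> ks; apply: lt2; exact: map_f.
rewrite !big_cat !big_cons /= ![\prod_(i <- s1) _]big1_seq ?mul1r.
- rewrite mnmDE mnm1E eqxx add1n exprS -mulrA; congr (_ * (_ * _)).
  apply: eq_big_seq => k /lt2 jk; rewrite mnmDE mnm1E -val_eqE /=.
  by rewrite ltn_eqF.
- by move=> k /andP[_ /lt1 kj]; rewrite alpha0.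
- by move=> k /andP[_ /lt1 kj]; rewrite mnmDE mnm1E -val_eqE /= gtn_eqF // alpha0.
Qed.

Fact mnm_split alpha : alpha != 0%MM ->
  exists (j : 'I_n) alpha', alpha = (U_(j) + alpha')%MM /\
    (forall k : 'I_n, (k < j)%N -> alpha' k = 0%N).
Proof.
move=> alpha0; have [j0 j0P] : exists j, alpha j != 0%N.
  apply/existsP; apply: contraNT alpha0 => /existsPn H; apply/eqP/mnmP => i.
  by rewrite mnm0E; apply/eqP; have := H i; rewrite negbK.
case: (@arg_minnP _ j0 (fun j => alpha j != 0%N) val j0P) => j jP jmin.
exists j, (alpha - U_(j))%MM; split.
  apply/mnmP => i; rewrite mnmDE mnmBE mnm1E.
  by case: eqVneq => [<-|_]; rewrite ?add0n ?subn0 // subnKC // lt0n.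
move=> k kj; rewrite mnmBE; suff -> : alpha k = 0%N by [].
by apply/eqP; apply: contraTT kj => /jmin; rewrite -leqNgt.
Qed.

Definition var_xmon_deg (d : nat) : Prop := forall i alpha, (mdeg alpha < d)%N ->
  exists c, exists2 f, deg_lt (mdeg alpha).+1 f
    & var P i * xmon alpha = emb P c * xmon (U_(i) + alpha)%MM + f.

Fact deg_lt_var d i f : var_xmon_deg d -> deg_lt d f -> deg_lt d.+1 (var P i * f).
Proof.
move=> Hd df; rewrite -[f]coordE /mmap mulr_sumr.
apply: deg_lt_sum => u /msize_mdeg_lt u_lt.
rewrite mulrA var_scalarE mulrDl -!mulrA.
have ud : (mdeg u < d)%N by exact: leq_trans u_lt df.
apply: deg_ltD; apply: deg_ltZ; last first.
  by apply: deg_ltW (deg_lt_xmon u); rewrite ltnS ltnW.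
have [c [g dg ->]] := Hd i u ud; apply: deg_ltD.
  by apply: deg_ltZ; apply: deg_ltW (deg_lt_xmon _); rewrite mdegD mdeg1.
by apply: deg_ltW dg; rewrite ltnS ltnW.
Qed.

Fact var_xmon d : var_xmon_deg d.
Proof.
elim: d => [//|d IH] i alpha; rewrite ltnS => alpha_d.
have [->|/mnm_split[j [u [def_alpha u0]]]] := eqVneq alpha 0%MM.
  exists 1, 0; first exact: deg_lt0.
  by rewrite rmorph1 mul1r addr0 xmon_var // => k _; rewrite mnm0E.
have degE : mdeg alpha = (mdeg u).+1 by rewrite def_alpha mdegD mdeg1.
have ud : (mdeg u < d)%N by rewrite -degE.
case: (leqP i j) => ij.
  exists 1, 0; first exact: deg_lt0.
  rewrite rmorph1 mul1r addr0 xmon_var // => k ki.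
  have kj : (k < j)%N by exact: leq_trans ki ij.
  by rewrite def_alpha mnmDE mnm1E u0 // addn0 -val_eqE /= gtn_eqF.
have [r [e /eqP]] := var_var P j i; rewrite subr_eq => /eqP xij.
have [c [f df xu]] := IH i u ud.
exists (cvar P j i * sigma j c).
have xiu0 (k : 'I_n) : (k < j)%N -> (U_(i) + u)%MM k = 0%N.
  by move=> kj; rewrite mnmDE mnm1E u0 // addn0 -val_eqE /= gtn_eqF // (ltn_trans kj).
exists (emb P (cvar P j i) * (emb P (delta j c) * xmon (U_(i) + u)%MM + var P j * f)
        + (emb P r + \sum_(k < n) emb P (e k) * var P k) * xmon u).
  have Hu : var_xmon_deg (mdeg u).+1.
    by move=> k v vu; apply: IH; exact: leq_trans vu ud.
  apply: deg_ltD.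
    apply: deg_ltZ; apply: deg_ltD; last by rewrite degE; exact: deg_lt_var.
    by apply: deg_ltZ; apply: deg_ltW (deg_lt_xmon _); rewrite mdegD mdeg1 degE.
  rewrite mulrDl; apply: deg_ltD.
    by apply: deg_ltZ; apply: deg_ltW (deg_lt_xmon _); rewrite degE.
  rewrite mulr_suml; apply: deg_lt_sum => k _; rewrite -mulrA; apply: deg_ltZ.
  by rewrite degE; apply: deg_lt_var => //; exact: deg_lt_xmon.
rewrite {1}def_alpha xmon_var // mulrA xij mulrDl addrC addrA; congr (_ + _).
rewrite -!mulrA xu mulrDr !mulrA var_scalarE.
have -> : (U_(i) + alpha = U_(j) + (U_(i) + u))%MM.
  by rewrite def_alpha !addmA (addmC U_(i)%MM).
by rewrite (xmon_var xiu0) rmorphM !(mulrDl, mulrDr) !mulrA !addrA.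
Qed.

Lemma xmonM alpha beta : exists2 f, deg_lt (mdeg (alpha + beta)) f
  & xmon alpha * xmon beta = emb P (cmon alpha beta) * xmon (alpha + beta)%MM + f.
Proof.
suff [c [f df E]] : exists c, exists2 f, deg_lt (mdeg (alpha + beta)) f
  & xmon alpha * xmon beta = emb P c * xmon (alpha + beta)%MM + f.
  exists f => //; rewrite {1}E; congr (emb P _ * _ + _).
  rewrite /cmon E coordD coordZ coord_xmon mcoeffD mcoeffZ mcoeffX eqxx mulr1.
  by rewrite [X in _ + X]memN_msupp_eq0 ?addr0 //; apply: contraTN df => /msize_mdeg_lt; rewrite -ltnNge.
have [d] := ubnP (mdeg alpha); elim: d alpha => // d IH alpha; rewrite ltnS => alpha_d.
have [->|/mnm_split[j [u [def_alpha u0]]]] := eqVneq alpha 0%MM.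
  exists 1, 0; first exact: deg_lt0.
  by rewrite add0m rmorph1 addr0 /xmon mmap11.
have degE : mdeg (U_(j) + u + beta) = (mdeg (u + beta)).+1.
  by rewrite -addmA mdegD mdeg1.
have ud : (mdeg u < d)%N by move: alpha_d; rewrite def_alpha mdegD mdeg1.
have [c [f df E]] := IH u ud.
have [c' [g dg E']] := @var_xmon (mdeg (u + beta)).+1 j (u + beta)%MM (ltnSn _).
rewrite def_alpha; exists (sigma j c * c').
exists (emb P (sigma j c) * g + emb P (delta j c) * xmon (u + beta)%MM + var P j * f).
  rewrite degE; apply: deg_ltD; last by apply: deg_lt_var => //; exact: var_xmon.
  by apply: deg_ltD; apply: deg_ltZ => //; exact: deg_lt_xmon.
rewrite xmon_var // -mulrA E mulrDr !mulrA var_scalarE mulrDl -mulrA E' -addmA.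
by rewrite rmorphM mulrDr !mulrA !addrA.
Qed.

Definition bijective_PBW : Prop :=
  (forall i, bijective (sigma i)) /\
  (forall i j, exists d : R, cvar P i j * d = 1 /\ d * cvar P i j = 1).

Definition sigma_exp alpha : R -> R :=
  \big[(fun f g => f \o g)/idfun]_(i < n) iter (alpha i) (sigma i).

Section Bijective.
Hypothesis bijP : bijective_PBW.

Fact sigma_exp_bij alpha : bijective (sigma_exp alpha).
Proof.
rewrite /sigma_exp; elim/big_rec: _ => [|i f _ bij_f]; first by exists idfun.
apply: bij_comp => //; elim: (alpha i) => [|k IH] /=; first by exists idfun.
by apply: bij_comp IH; case: bijP.
Qed.

Definition psi theta1 theta2 : R -> R :=
  sigma_exp (theta1 + theta2)%MM \o inv_bij (sigma_exp_bij theta2).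

Fact psi_bij theta1 theta2 : bijective (psi theta1 theta2).
Proof. by apply: bij_comp; [exact: sigma_exp_bij | exact: inv_bij_bij]. Qed.

Definition psi_inv theta1 theta2 : R -> R := inv_bij (psi_bij theta1 theta2).
End Bijective.

Section Vectors.
Context (m : nat).

(* (alpha, i) encodes the monomial x^alpha e_i; in [option monomial], [None]
   encodes the vector 0. *)
Definition monomial : Type := 'X_{1..n} * 'I_m.
Notation vec := {ffun 'I_m -> A}.
Implicit Types (X Y : monomial) (f g h : vec) (F G : {fset vec}).

(* [le X Y] is "Y succeq X". *)
Definition monomial_order (le : rel monomial) : Prop :=
  [/\ [/\ reflexive le, antisymmetric le, transitive le & total le],
      forall alpha beta i, le (alpha, i) ((beta + alpha)%MM, i),
      forall alpha beta gamma i j, le (alpha, i) (beta, j) ->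
        le ((gamma + alpha)%MM, i) ((gamma + beta)%MM, j)
    & forall X Y, (mdeg Y.1 < mdeg X.1)%N -> le Y X && (Y != X)].

Definition coef f X : R := (coord (f X.2))@_X.1.

Definition monomials f : seq monomial :=
  [seq (alpha, i) | i <- enum 'I_m, alpha <- msupp (coord (f i))].

Definition mlcms (s : seq monomial) : option monomial :=
  if s is X :: s' then
    if all (fun Y => Y.2 == X.2) s'
    then Some (\big[@mlcm n/0%MM]_(Y <- s) Y.1, X.2) else None
  else None.

Section Order.
Context (le : rel monomial).

Definition lm f : option monomial :=
  ohead (sort (fun X Y => le Y X) (monomials f)).
Definition lc f : R := if lm f is Some X then coef f X else 0.
Definition lexp f : 'X_{1..n} := if lm f is Some X then X.1 else 0%MM.

Definition reduces1 F f h : Prop :=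
  (f = 0 /\ h = 0) \/
  exists X, lm f = Some X /\
  exists (t : nat) (fs : 'I_t -> vec) (r : 'I_t -> R) (beta alpha : 'I_t -> 'X_{1..n}),
  [/\ forall k, [/\ fs k \in F, lm (fs k) = Some (beta k, X.2)
                  & (beta k + alpha k)%MM = X.1],
      lc f = \sum_(k < t)
               lc (fs k) * sigma_exp (beta k) (r k) * cmon (beta k) (alpha k)
    & h = f - \sum_(k < t) rscale (fs k) (emb P (r k) * xmon (alpha k))].

Definition reduces F : vec -> vec -> Prop := clos_trans vec (reduces1 F).

Definition reducible F f : Prop := f <> 0 /\ exists h, reduces1 F f h.

Definition groebner_basis (M : vec -> Prop) G : Prop :=
  [/\ G != fset0, forall g, g \in G -> M g /\ g != 0
    & forall f, M f -> f != 0 -> reducible G f].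

Definition X_ F : option monomial := mlcms (pmap lm (enum_fset F)).

Definition gamma_ (mu : 'X_{1..n}) g : 'X_{1..n} := (mu - lexp g)%MM.

Definition lead_row F (mu : 'X_{1..n}) : {ffun F -> R} :=
  [ffun g : F => lc (val g) * cmon (lexp (val g)) (gamma_ mu (val g))].

(* The components of the vectors of R^s are indexed by the elements of
   F = {g_1, ..., g_s} rather than by 1, ..., s. *)
Definition syz_generators (B : forall F : {fset vec}, {fset {ffun F -> R}}) : Prop :=
  forall F X, F != fset0 -> (forall g, g \in F -> g != 0) -> X_ F = Some X ->
    generates (B F) (syz (lead_row F X.1)).
End Order.
End Vectors.
End SkewPBW.

(* Main.v *)
From HB Require Import structures.
From Stdlib Require Import Relation_Operators.
From mathcomp Require Import all_boot all_order all_algebra finmap.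
Require Import Defs.

Set Implicit Arguments.
Unset Strict Implicit.
Unset Printing Implicit Defensive.

Import GRing.Theory.
Local Open Scope fset_scope.
Local Open Scope ring_scope.

(** A Groebner basis reduces every element of M to 0: a reduction step stays in
M and strictly lowers the leading monomial, and a monomial order is
well-founded. The combinations in (ii) belong to M, so (i) implies (ii).

For the converse, write a nonzero f in M as a sum of terms g r x^a with g in G, and let X
be the largest of the monomials lm(g) x^a. Only the g in the set D of elements
of G whose leading monomial divides X contribute to the coefficient c of X in
f. If c is nonzero, then X = lm(f), and the terms of level X are a one-step
reduction of f. If c = 0, the point is to rewrite the terms of level X as a sum
of terms of lower level ([rep_top_part]); well-founded induction on X then
shows that f is reducible.

Let X_D be the lcm of the leading monomials of D and X = x^theta X_D. The
equation c = 0 involves the structure constants c_{beta, gamma + theta}. The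
associativity of x^beta x^gamma x^theta ([cmonA]) together with the
invertibility of the structure constants ([invertible_cmon]) turns it into an
equation with the constants c_{beta, gamma} only, and
  sigma^beta(r) c_{beta, gamma} = c_{beta, gamma} psi_{beta, gamma}(r)
([sigma_cmon]) turns the latter into a syzygy of the elements
lc(g) c_{beta, gamma}. Such a syzygy is a combination of the b in B_D with
coefficients a_b in R. The twist psi is chosen so that a_b can be moved across
x^gamma: modulo lower terms
  psi^{-1}(a_b) x^gamma = x^gamma sigma^{-(beta + gamma)}(a_b),
where beta + gamma = exp(X_D) is the same for all g in D. Hence the terms of
level X are, modulo lower terms, the sum over b of
  S_b sigma^{-exp(X_D)}(a_b) x^theta
where S_b is the combination in (ii) attached to b. As S_b has no term at X_D
or above and reduces to 0, it is a sum of terms of level below X_D, so that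
S_b (..) x^theta is a sum of terms of level below X.

All the leading coefficients are computed by [symbolM], the product rule for
leading terms in A modulo lower degree. *)

(** * Leading terms in the filtered ring A *)

Section Symbols.
Context (n : nat) (R A : nzRingType) (P : skewPBW n R A).
Implicit Types (u v w : 'X_{1..n}) (f g : A) (a b c r s : R).

Fact coord_zmod_morphism : zmod_morphism (coord P).
Proof.
by move=> f g; rewrite -[f](coordE P) -[g](coordE P) -raddfB /= !coord_mmap.
Qed.

HB.instance Definition _ :=
  GRing.isZmodMorphism.Build A {mpoly R[n]} (coord P) coord_zmod_morphism.

Lemma pbw_expand f :
  f = \sum_(u <- msupp (coord P f)) emb P (coord P f)@_u * xmon P u.
Proof. by rewrite -[LHS](coordE P). Qed.

Lemma coord_cst_xmon c u v :
  (coord P (emb P c * xmon P u))@_v = if u == v then c else 0.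
Proof.
rewrite coordZ coord_xmon mcoeffZ mcoeffX.
by case: (u == v); rewrite ?mulr1 ?mulr0.
Qed.

Lemma deg_ltB d f g : deg_lt P d f -> deg_lt P d g -> deg_lt P d (f - g).
Proof.
move=> df dg; apply: deg_ltD => //; rewrite -mulN1r -(rmorph1 (emb P)) -rmorphN.
exact: deg_ltZ.
Qed.

Lemma deg_lt_coord d f u : deg_lt P d f -> (d <= mdeg u)%N -> (coord P f)@_u = 0.
Proof.
move=> df du; apply: memN_msupp_eq0; apply/negP => /msize_mdeg_lt.
by rewrite ltnNge (leq_trans df du).
Qed.

Lemma deg_lt_coord_neq0 d f u :
  deg_lt P d f -> (coord P f)@_u != 0 -> (mdeg u < d)%N.
Proof. by move=> df; apply: contraNT; rewrite -leqNgt => /(deg_lt_coord df) ->. Qed.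

Lemma deg_lt_xmonM e u g : deg_lt P e g -> deg_lt P (mdeg u + e) (xmon P u * g).
Proof.
have [d] := ubnP (mdeg u); elim: d u => // d IH u; rewrite ltnS => u_d dg.
have [->|/mnm_split[j [v [def_u v0]]]] := eqVneq u 0%MM.
  by rewrite mdeg0 /xmon mmap11 mul1r.
have degE : mdeg u = (mdeg v).+1 by rewrite def_u mdegD mdeg1.
rewrite degE def_u xmon_var // -mulrA; apply: deg_lt_var; first exact: var_xmon.
by apply: IH => //; rewrite -degE.
Qed.

(** Degrees add; the predecessor comes from [deg_lt d] meaning degree at most
d - 1. *)
Lemma deg_ltM d e f g :
  deg_lt P d f -> deg_lt P e g -> deg_lt P (d + e).-1 (f * g).
Proof.
move=> df dg; rewrite (pbw_expand f) mulr_suml; apply: deg_lt_sum => u.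
move=> /msize_mdeg_lt uf; rewrite -mulrA; apply: deg_ltZ.
apply: deg_ltW (deg_lt_xmonM u dg).
have : (mdeg u < d)%N by exact: leq_trans uf df.
by case: d {df} => // d; rewrite ltnS addSn /= leq_add2r.
Qed.

Lemma deg_lt_emb c : deg_lt P 1 (emb P c).
Proof.
rewrite -[emb P c]mulr1; apply: deg_ltZ.
by have := @deg_lt_xmon _ _ _ P 0%MM; rewrite mdeg0 /xmon mmap11.
Qed.

(** Unlike a leading coefficient, c may be 0; this makes the relation additive
in c and f. *)
Definition symbol u c f := deg_lt P (mdeg u) (f - emb P c * xmon P u).

Lemma symbol_deg_lt u c f : symbol u c f -> deg_lt P (mdeg u).+1 f.
Proof.
move=> su; rewrite -(subrK (emb P c * xmon P u) f); apply: deg_ltD.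
  by apply: deg_ltW su.
by apply: deg_ltZ; exact: deg_lt_xmon.
Qed.

Lemma symbol_coord u c f : symbol u c f -> (coord P f)@_u = c.
Proof.
move=> /deg_lt_coord/(_ (leqnn _)) /eqP.
by rewrite raddfB mcoeffB coord_cst_xmon eqxx subr_eq0 => /eqP.
Qed.

Lemma symbol_uniq u c c' f : symbol u c f -> symbol u c' f -> c = c'.
Proof. by move=> /symbol_coord <- /symbol_coord. Qed.

Lemma symbol_term u c : symbol u c (emb P c * xmon P u).
Proof. by rewrite /symbol subrr; exact: deg_lt0. Qed.

Lemma symbol_xmon u : symbol u 1 (xmon P u).
Proof. by have := symbol_term u 1; rewrite rmorph1 mul1r. Qed.

Lemma symbol_emb c : symbol 0%MM c (emb P c).
Proof. by have := symbol_term 0%MM c; rewrite /xmon mmap11 mulr1. Qed.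

Lemma symbolB u c c' f g : symbol u c f -> symbol u c' g -> symbol u (c - c') (f - g).
Proof.
move=> sf sg; rewrite /symbol rmorphB mulrBl opprD addrACA -opprD.
exact: deg_ltB sf sg.
Qed.

Lemma symbol0 u : symbol u 0 0.
Proof. by rewrite /symbol raddf0 mul0r subrr; exact: deg_lt0. Qed.

Lemma symbolD u c c' f g : symbol u c f -> symbol u c' g -> symbol u (c + c') (f + g).
Proof.
move=> sf sg; have := symbolB sf (symbolB (symbol0 u) sg).
by rewrite !sub0r !opprK.
Qed.

Lemma symbol_sum (I : Type) (s : seq I) u (c : I -> R) (f : I -> A) :
  (forall i, symbol u (c i) (f i)) ->
  symbol u (\sum_(i <- s) c i) (\sum_(i <- s) f i).
Proof.
move=> sf; elim/big_ind2: _ => //; first exact: symbol0.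
by move=> *; exact: symbolD.
Qed.

Lemma deg_lt_var_pow (i : 'I_n) k : deg_lt P k.+1 (var P i ^+ k).
Proof.
elim: k => [|k IH]; first by rewrite expr0 -(rmorph1 (emb P)); exact: deg_lt_emb.
by rewrite exprS; apply: deg_lt_var => //; exact: var_xmon.
Qed.

Lemma var_pow_symbol (i : 'I_n) k r :
  exists2 f, deg_lt P k f
  & var P i ^+ k * emb P r = emb P (iter k (sigma P i) r) * var P i ^+ k + f.
Proof.
elim: k => [|k [f df E]]; first by exists 0; [exact: deg_lt0 | rewrite mul1r mulr1 addr0].
exists (emb P (delta P i (iter k (sigma P i) r)) * var P i ^+ k + var P i * f).
  apply: deg_ltD; first by apply: deg_ltZ; exact: deg_lt_var_pow.
  by apply: deg_lt_var => //; exact: var_xmon.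
rewrite exprS -mulrA E mulrDr mulrA var_scalarE mulrDl -!mulrA -exprS addrA.
by rewrite iterS.
Qed.

(** Moving r through the ordered product x^u one block x_i^(u_i) at a time
produces the factors of [sigma_exp] in the same order. This holds for
the product over any list of indices, over which the induction runs. *)
Lemma sigma_symbol u r : symbol u (sigma_exp P u r) (xmon P u * emb P r).
Proof.
rewrite /symbol /xmon /mmap1 /sigma_exp mdegE.
suff [f df ->] : exists2 f, deg_lt P (\sum_(i < n) u i) f
  & \prod_(i < n) var P i ^+ u i * emb P r =
    emb P ((\big[(fun p q => p \o q)/idfun]_(i < n) iter (u i) (sigma P i)) r)
      * \prod_(i < n) var P i ^+ u i + f by rewrite addrAC subrr add0r.
have dprod (js : seq 'I_n) :
    deg_lt P (\sum_(i <- js) u i).+1 (\prod_(i <- js) var P i ^+ u i).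
  elim: js => [|i js IH]; rewrite !(big_nil, big_cons).
    by rewrite -(rmorph1 (emb P)); exact: deg_lt_emb.
  by have := deg_ltM (deg_lt_var_pow i (u i)) IH; rewrite addSn addnS.
elim: (index_enum 'I_n) => [|i js [f df E]]; rewrite !(big_nil, big_cons).
  by exists 0; [exact: deg_lt0 | rewrite mul1r mulr1 addr0].
set t := (X in emb P (X r)) in E.
have [g dg E'] := var_pow_symbol i (u i) (t r).
exists (g * (\prod_(j <- js) var P j ^+ u j) + var P i ^+ u i * f).
  apply: deg_ltD; first by have := deg_ltM dg (dprod js); rewrite addnS.
  by have := deg_ltM (deg_lt_var_pow i (u i)) df.
by rewrite -mulrA E mulrDr mulrA E' mulrDl !mulrA addrA.
Qed.

(** Three congruences are chained: f by a x^u and g by b x^v, then x^u b by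
sigma^u(b) x^u, then x^u x^v by c_{u,v} x^(u+v). *)
Lemma symbolM u v a b f g : symbol u a f -> symbol v b g ->
  symbol (u + v)%MM (a * sigma_exp P u b * cmon P u v) (f * g).
Proof.
move=> sf sg; have df := symbol_deg_lt sf; have dg := symbol_deg_lt sg.
rewrite /symbol; set m := (X in f * g - X).
have -> : f * g - m = (f - emb P a * xmon P u) * g
    + (emb P a * xmon P u * (g - emb P b * xmon P v)
       + (emb P a * xmon P u * (emb P b * xmon P v) - m)).
  by rewrite mulrBl mulrBr !addrA !subrK.
have -> : emb P a * xmon P u * (emb P b * xmon P v) =
    emb P a * ((xmon P u * emb P b - emb P (sigma_exp P u b) * xmon P u) * xmon P v)
    + emb P a * (emb P (sigma_exp P u b) * (xmon P u * xmon P v)).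
  by rewrite -mulrDr mulrBl -!mulrA subrK.
rewrite mdegD; apply: deg_ltD; first by have := deg_ltM sf dg; rewrite addnS.
have dm : deg_lt P (mdeg u).+1 (emb P a * xmon P u).
  by apply: deg_ltZ; exact: deg_lt_xmon.
apply: deg_ltD; first by have := deg_ltM dm sg; rewrite addSn.
rewrite -addrA; apply: deg_ltD.
  apply: deg_ltZ.
  by have := deg_ltM (sigma_symbol u b) (@deg_lt_xmon _ _ _ P v); rewrite addnS.
have [h dh ->] := xmonM P u v; rewrite /m !rmorphM -!mulrA !mulrDr addrAC subrr add0r.
by apply: deg_ltZ; apply: deg_ltZ; rewrite -mdegD.
Qed.

Lemma sigma_expD u r s : sigma_exp P u (r + s) = sigma_exp P u r + sigma_exp P u s.
Proof.
have := sigma_symbol u (r + s); rewrite rmorphD mulrDr => /symbol_uniq; apply.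
by apply: symbolD; exact: sigma_symbol.
Qed.

Lemma sigma_exp1 u : sigma_exp P u 1 = 1.
Proof.
have := sigma_symbol u 1; rewrite rmorph1 mulr1 => /symbol_uniq; apply.
exact: symbol_xmon.
Qed.

Lemma cmon_r0 u : cmon P u 0%MM = 1.
Proof.
by rewrite /cmon /xmon mmap11 mulr1 addm0 (symbol_coord (symbol_xmon u)).
Qed.

Lemma cmon_l0 u : cmon P 0%MM u = 1.
Proof.
by rewrite /cmon /xmon mmap11 mul1r add0m (symbol_coord (symbol_xmon u)).
Qed.

Lemma sigma_expM u r s : sigma_exp P u (r * s) = sigma_exp P u r * sigma_exp P u s.
Proof.
have := symbolM (sigma_symbol u r) (symbol_emb s).
rewrite cmon_r0 mulr1 addm0 -(mulrA (xmon P u)) -rmorphM.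
exact: symbol_uniq (sigma_symbol _ _).
Qed.

(** Both sides are the leading coefficient of x^u x^v s, bracketed in two ways. *)
Lemma sigma_expA u v s :
  cmon P u v * sigma_exp P (u + v)%MM s = sigma_exp P u (sigma_exp P v s) * cmon P u v.
Proof.
have := symbolM (symbolM (symbol_xmon u) (symbol_xmon v)) (symbol_emb s).
rewrite -(mulrA (xmon P u)) => /symbol_coord.
have := symbolM (symbol_xmon u) (sigma_symbol v s); rewrite addm0 => /symbol_coord ->.
by rewrite cmon_r0 mulr1 sigma_exp1 !mul1r.
Qed.

(** Both sides are the leading coefficient of x^u x^v x^w, bracketed in two
ways. *)
Lemma cmonA u v w :
  cmon P u v * cmon P (u + v)%MM w = sigma_exp P u (cmon P v w) * cmon P u (v + w)%MM.
Proof.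
have := symbolM (symbolM (symbol_xmon u) (symbol_xmon v)) (symbol_xmon w).
rewrite -(mulrA (xmon P u)) => /symbol_coord.
have := symbolM (symbol_xmon u) (symbolM (symbol_xmon v) (symbol_xmon w)).
rewrite addmA => /symbol_coord ->.
by rewrite !sigma_exp1 !mul1r mulr1 => <-.
Qed.
End Symbols.

(** * Structure constants of a bijective extension *)

Section Units.
Context (n : nat) (R A : nzRingType) (P : skewPBW n R A).
Hypothesis bijP : bijective_PBW P.
Implicit Types (u v w : 'X_{1..n}) (a b c r s : R).

Definition invertible (c : R) := exists d, c * d = 1 /\ d * c = 1.

Lemma invertible1 : invertible 1.
Proof. by exists 1; rewrite mulr1. Qed.

Lemma invertibleM c c' : invertible c -> invertible c' -> invertible (c * c').
Proof.
move=> [d [cd dc]] [d' [cd' dc']]; exists (d' * d).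
by rewrite -!mulrA (mulrA c') cd' mul1r (mulrA d) dc mul1r.
Qed.

Lemma invertible_sigma u c : invertible c -> invertible (sigma_exp P u c).
Proof.
by move=> [d [cd dc]]; exists (sigma_exp P u d); rewrite -!sigma_expM cd dc sigma_exp1.
Qed.

Lemma xmonU (i : 'I_n) : xmon P U_(i)%MM = var P i.
Proof. exact: mmap1U. Qed.

(** Here x_j x^u is already an ordered monomial. *)
Lemma cmon_var (j : 'I_n) u : (forall k : 'I_n, (k < j)%N -> u k = 0%N) ->
  cmon P U_(j)%MM u = 1.
Proof.
by move=> u0; rewrite /cmon xmonU -xmon_var // (symbol_coord (symbol_xmon P _)).
Qed.

Lemma cmon_var_var (i j : 'I_n) : (j < i)%N -> cmon P U_(i)%MM U_(j)%MM = cvar P j i.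
Proof.
move=> ji; rewrite /cmon !xmonU; apply: symbol_coord.
have [d [e E]] := var_var P j i.
have xji : xmon P (U_(i) + U_(j))%MM = var P j * var P i.
  rewrite addmC xmon_var ?xmonU // => k kj; rewrite mnm1E -val_eqE /=.
  by rewrite gtn_eqF // (ltn_trans kj).
rewrite /symbol xji mdegD !mdeg1.
rewrite mulrA E; apply: deg_ltD; first by apply: deg_ltW (deg_lt_emb P d).
apply: deg_lt_sum => k _; apply: deg_ltZ; rewrite -xmonU.
by have := @deg_lt_xmon _ _ _ P U_(k)%MM; rewrite mdeg1.
Qed.

(** If j < i is the least index in u = U_(j) + v, comparing x_i x_j x^v with
x_j x_i x^v through [cmonA] gives c_{i,u} = c_{j,i} sigma_j(c_{i,v}), where
c_{j,i} is a defining constant of the extension. *)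
Lemma invertible_cmon_var (i : 'I_n) u : invertible (cmon P U_(i)%MM u).
Proof.
have [d] := ubnP (mdeg u); elim: d u => // d IH u; rewrite ltnS => u_d.
have [->|/mnm_split[j [v [def_u v0]]]] := eqVneq u 0%MM.
  by rewrite cmon_r0; exact: invertible1.
have v_d : (mdeg v < d)%N by move: u_d; rewrite def_u mdegD mdeg1.
have [ij|ji] := leqP i j.
  rewrite cmon_var; first exact: invertible1.
  move=> k ki; have kj := leq_trans ki ij.
  by rewrite def_u mnmDE mnm1E v0 // -val_eqE /= gtn_eqF.
have E1 := cmonA P U_(i)%MM U_(j)%MM v.
rewrite (cmon_var v0) sigma_exp1 mul1r -def_u in E1.
have E2 := cmonA P U_(j)%MM U_(i)%MM v.
have [u0 vi0] : (forall k : 'I_n, (k < j)%N -> U_(i)%MM k = 0%N)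
    /\ (forall k : 'I_n, (k < j)%N -> (U_(i) + v)%MM k = 0%N).
  split=> k kj; rewrite ?mnmDE mnm1E ?v0 // -val_eqE /=;
    by rewrite gtn_eqF // (ltn_trans kj).
rewrite (cmon_var u0) (cmon_var vi0) mulr1 mul1r in E2.
rewrite -E1 addmC E2 cmon_var_var //; apply: invertibleM; first exact: bijP.2.
by apply: invertible_sigma; exact: IH.
Qed.

(** Peeling the first variable off x^u reduces the claim to products
x_j x^w, by [cmonA]. *)
Lemma invertible_cmon u v : invertible (cmon P u v).
Proof.
have [d] := ubnP (mdeg u); elim: d u => // d IH u; rewrite ltnS => u_d.
have [->|/mnm_split[j [w [def_u w0]]]] := eqVneq u 0%MM.
  by rewrite cmon_l0; exact: invertible1.
have := cmonA P U_(j)%MM w v; rewrite (cmon_var w0) mul1r -def_u => ->.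
apply: invertibleM; last exact: invertible_cmon_var.
by apply: invertible_sigma; apply: IH; move: u_d; rewrite def_u mdegD mdeg1.
Qed.

Lemma cmon_lreg u v : GRing.lreg (cmon P u v).
Proof.
have [d [_ dc]] := invertible_cmon u v => a b E.
by rewrite -[a]mul1r -[b]mul1r -dc -!mulrA E.
Qed.

Lemma cmon_rreg u v : GRing.rreg (cmon P u v).
Proof.
have [d [cd _]] := invertible_cmon u v => a b E.
by rewrite -[a]mulr1 -[b]mulr1 -cd !mulrA E.
Qed.

Lemma psi_sigma u v r : psi bijP u v (sigma_exp P v r) = sigma_exp P (u + v)%MM r.
Proof. by rewrite /psi /= inv_bijK. Qed.

Lemma psiK u v : cancel (psi bijP u v) (psi_inv bijP u v).
Proof. exact: inv_bijK. Qed.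

Lemma psi_invK u v : cancel (psi_inv bijP u v) (psi bijP u v).
Proof. exact: inv_bijKr. Qed.

(** This is [sigma_expA] with r = sigma^v(s), and the reason for the definition
of psi. *)
Lemma sigma_cmon u v r :
  sigma_exp P u r * cmon P u v = cmon P u v * psi bijP u v r.
Proof.
have [s <-] : exists s, sigma_exp P v s = r.
  by have [t _ tK] := sigma_exp_bij bijP v; exists (t r).
by rewrite psi_sigma sigma_expA.
Qed.

Lemma psiD u v r s : psi bijP u v (r + s) = psi bijP u v r + psi bijP u v s.
Proof.
by apply: (@cmon_lreg u v); rewrite mulrDr -!sigma_cmon sigma_expD mulrDl.
Qed.

Lemma psiM u v r s : psi bijP u v (r * s) = psi bijP u v r * psi bijP u v s.
Proof.
apply: (@cmon_lreg u v); rewrite mulrA -!sigma_cmon sigma_expM -!mulrA.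
by rewrite sigma_cmon.
Qed.

Lemma psi0 u v : psi bijP u v 0 = 0.
Proof. by apply: (addrI (psi bijP u v 0)); rewrite -psiD !addr0. Qed.

Lemma psi_sum u v (I : Type) (s : seq I) (F : I -> R) :
  psi bijP u v (\sum_(i <- s) F i) = \sum_(i <- s) psi bijP u v (F i).
Proof. by apply: (big_morph _ (psiD u v) (psi0 u v)). Qed.
End Units.

(** * Leading monomials of vectors *)

Section Rscale.
Context (S : nzRingType) (I : finType).
Implicit Types (v w : {ffun I -> S}) (a b : S).

Lemma rscaleDl v w a : rscale (v + w) a = rscale v a + rscale w a.
Proof. by apply/ffunP => i; rewrite !ffunE mulrDl. Qed.

Lemma rscaleDr v a b : rscale v (a + b) = rscale v a + rscale v b.
Proof. by apply/ffunP => i; rewrite !ffunE mulrDr. Qed.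

Lemma rscale0l a : rscale (0 : {ffun I -> S}) a = 0.
Proof. by apply/ffunP => i; rewrite !ffunE mul0r. Qed.

Lemma rscale0r v : rscale v 0 = 0.
Proof. by apply/ffunP => i; rewrite !ffunE mulr0. Qed.

Lemma rscale1 v : rscale v 1 = v.
Proof. by apply/ffunP => i; rewrite !ffunE mulr1. Qed.

Lemma rscaleNr v a : rscale v (- a) = - rscale v a.
Proof. by apply/ffunP => i; rewrite !ffunE mulrN. Qed.

Lemma rscaleA v a b : rscale (rscale v a) b = rscale v (a * b).
Proof. by apply/ffunP => i; rewrite !ffunE mulrA. Qed.

Lemma rscale_suml (J : Type) (s : seq J) (F : J -> {ffun I -> S}) a :
  rscale (\sum_(j <- s) F j) a = \sum_(j <- s) rscale (F j) a.
Proof.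
by elim/big_rec2: _ => [|j v w _ <-]; [exact: rscale0l | exact: rscaleDl].
Qed.

Lemma rscale_sumr (J : Type) (s : seq J) (F : J -> S) v :
  rscale v (\sum_(j <- s) F j) = \sum_(j <- s) rscale v (F j).
Proof. by apply: (big_morph _ (rscaleDr v)); exact: rscale0r. Qed.

Section Submodules.
Context (M : {ffun I -> S} -> Prop) (hM : right_submodule M).

Lemma right_submodule_sum (J : Type) (s : seq J) (F : J -> {ffun I -> S}) :
  (forall j, M (F j)) -> M (\sum_(j <- s) F j).
Proof. by case: hM => M0 MD _ MF; elim/big_rec: _ => // j v _; apply: MD. Qed.

Lemma right_submoduleB v w : M v -> M w -> M (v - w).
Proof.
case: hM => _ MD MZ Mv Mw; apply: MD => //.
by rewrite -[w]rscale1 -rscaleNr; apply: MZ.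
Qed.
End Submodules.

Lemma generates_sub (G : {fset {ffun I -> S}}) M g : generates G M -> g \in G -> M g.
Proof.
move=> hG gG; apply/hG; exists (fun h => (h == g)%:R).
rewrite (bigD1_seq g) ?fset_uniq //= eqxx rscale1 big1 ?addr0 // => h /negPf ->.
exact: rscale0r.
Qed.
End Rscale.

Section LeadingMonomials.
Context (n : nat) (R A : nzRingType) (P : skewPBW n R A) (m : nat).
Context (le : rel (monomial n m)) (le_mo : monomial_order le).
Notation vec := {ffun 'I_m -> A}.
Notation mon := (monomial n m).
Implicit Types (f g h : vec) (X Y Z : mon) (u v w : 'X_{1..n}).

Definition ltm X Y := le X Y && (X != Y).
Definition shift X u : mon := ((X.1 + u)%MM, X.2).

Lemma le_refl X : le X X.
Proof. by case: le_mo => -[]. Qed.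

Lemma le_trans Y X Z : le X Y -> le Y Z -> le X Z.
Proof. by case: le_mo => -[_ _ t _] _ _ _; apply: t. Qed.

Lemma le_anti X Y : le X Y -> le Y X -> X = Y.
Proof. by case: le_mo => -[_ a _ _] _ _ _ xy yx; apply: a; rewrite xy. Qed.

Lemma ltmW X Y : ltm X Y -> le X Y.
Proof. by case/andP. Qed.

Lemma le_eqVlt X Y : le X Y -> X = Y \/ ltm X Y.
Proof. by move=> XY; rewrite /ltm XY; case: eqVneq => [|_]; [left | right]. Qed.

Lemma le_lt_trans Y X Z : le X Y -> ltm Y Z -> ltm X Z.
Proof.
move=> XY /andP[YZ nYZ]; rewrite /ltm (le_trans XY YZ).
by apply: contraNneq nYZ => XZ; rewrite (le_anti YZ) // -XZ.
Qed.

Lemma ltm_irr X : ~~ ltm X X.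
Proof. by rewrite /ltm eqxx andbF. Qed.

Lemma ltm_deg X Y : (mdeg X.1 < mdeg Y.1)%N -> ltm X Y.
Proof. by case: le_mo => _ _ _; apply. Qed.

Lemma le_shift X Y u : le X Y -> le (shift X u) (shift Y u).
Proof.
case: le_mo => _ _ H _; case: X Y => [a i] [b j] /(H _ _ u).
by rewrite /shift /= !(addmC _ u).
Qed.

Lemma shift_inj u : injective (shift^~ u).
Proof.
move=> [a i] [b j] E.
by rewrite (addIm (congr1 fst E) : a = b) (congr1 snd E : i = j).
Qed.

Lemma ltm_shift X Y u : ltm X Y -> ltm (shift X u) (shift Y u).
Proof.
by move=> /andP[XY nXY]; rewrite /ltm le_shift // (inj_eq (@shift_inj u)).
Qed.

(** The order refines the degree, so a descending chain stays within a bounded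
degree; among the finitely many monomials of bounded degree, the number of those
below X decreases strictly. *)
Lemma ltm_wf : well_founded ltm.
Proof.
move=> X0; have [d dX0] := ubnP (mdeg X0.1).
pose rank X := #|[set Y : 'X_{1..n < d} * 'I_m | ltm (bmnm Y.1, Y.2) X]|.
suff acc k X : (rank X < k)%N -> (mdeg X.1 < d)%N -> Acc ltm X.
  exact: (acc _ _ (ltnSn (rank X0)) dX0).
elim: k X => [|k IH] X; first by rewrite ltn0.
rewrite ltnS => rk dX.
constructor=> Y YX; have dY : (mdeg Y.1 < d)%N.
  rewrite ltnNge; apply/negP => dY.
  have /ltmW XY : ltm X Y by apply: ltm_deg; exact: leq_trans dX dY.
  by case/andP: YX => YX; rewrite (le_anti YX XY) eqxx.
apply: IH => //; apply: leq_trans rk; apply: proper_card; apply/properP; split.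
  by apply/subsetP => Z; rewrite !inE => /ltmW ZY; exact: le_lt_trans ZY YX.
exists (BMultinom dY, Y.2); rewrite !inE /= -?surjective_pairing //.
exact: ltm_irr.
Qed.

Lemma coefD f g X : coef P (f + g) X = coef P f X + coef P g X.
Proof. by rewrite /coef ffunE coordD mcoeffD. Qed.

Lemma coefB f g X : coef P (f - g) X = coef P f X - coef P g X.
Proof. by rewrite /coef !ffunE raddfB mcoeffB. Qed.

Lemma coef0 X : coef P 0 X = 0.
Proof. by rewrite -(subrr 0) coefB subrr. Qed.

Lemma coef_sum (J : Type) (s : seq J) (F : J -> vec) X :
  coef P (\sum_(j <- s) F j) X = \sum_(j <- s) coef P (F j) X.
Proof.
by elim/big_rec2: _ => [|j v f _ <-]; [exact: coef0 | exact: coefD].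
Qed.

Lemma coef_inj f : (forall X, coef P f X = 0) -> f = 0.
Proof.
move=> f0; apply/ffunP => i; rewrite ffunE -[f i](coordE P).
suff -> : coord P (f i) = 0 by rewrite raddf0.
by apply/mpolyP => u; rewrite mcoeff0; exact: (f0 (u, i)).
Qed.

Lemma mem_monomials f X : (X \in monomials P f) = (coef P f X != 0).
Proof.
case: X => u i; rewrite -mcoeff_msupp.
apply/allpairsPdep/idP => [[j [v [_ vf [-> ->]]]]|uf] //.
by exists i, u; rewrite mem_enum.
Qed.

Definition upto X f := forall Y, coef P f Y != 0 -> le Y X.
Definition below X f := forall Y, coef P f Y != 0 -> ltm Y X.

Lemma belowD X f g : below X f -> below X g -> below X (f + g).
Proof.
move=> bf bg Y; rewrite coefD => fg.
have [f0|/bf//] := eqVneq (coef P f Y) 0.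
by apply: bg; move: fg; rewrite f0 add0r.
Qed.

Lemma belowB X f g : below X f -> below X g -> below X (f - g).
Proof.
move=> bf bg; apply: belowD => // Y Y0; apply: bg.
by move: Y0; rewrite -sub0r coefB coef0 sub0r oppr_eq0.
Qed.

Lemma upto_below X f : upto X f -> coef P f X = 0 -> below X f.
Proof.
move=> uf f0 Y Y0; rewrite /ltm uf //.
by apply: contraNneq Y0 => ->; rewrite f0.
Qed.

Lemma upto_sum X (J : Type) (s : seq J) (F : J -> vec) :
  (forall j, upto X (F j)) -> upto X (\sum_(j <- s) F j).
Proof.
move=> uF; elim/big_rec: _ => [Y|j g _ ug Y]; first by rewrite coef0 eqxx.
rewrite coefD; have [->|/uF//] := eqVneq (coef P (F j) Y) 0.
by rewrite add0r => /ug.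
Qed.

Lemma uptoB X f g : upto X f -> upto X g -> upto X (f - g).
Proof.
move=> uf ug Y; rewrite coefB; have [->|/uf//] := eqVneq (coef P f Y) 0.
by rewrite sub0r oppr_eq0 => /ug.
Qed.

Lemma lmP f X : lm P le f = Some X <-> coef P f X != 0 /\ upto X f.
Proof.
rewrite /lm; set s := sort _ _.
have s_mem Y : (Y \in s) = (coef P f Y != 0) by rewrite mem_sort mem_monomials.
have s_sorted : sorted (fun Y Z => le Z Y) s.
  by apply: sort_sorted => Y Z; case: le_mo => -[_ _ _ t] _ _ _; exact: t.
have s_head Y t : s = Y :: t -> coef P f Y != 0 /\ upto Y f.
  move=> sE; rewrite -s_mem sE mem_head; split=> // Z; rewrite -s_mem sE inE.
  case/orP => [/eqP ->|Zt]; first exact: le_refl.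
  move: s_sorted; rewrite sE /= => /(order_path_min _) /allP; apply => //.
  by move=> a b c ab bc; exact: le_trans bc ab.
case sE: s => [|Y t] /=; split=> //.
- by rewrite -s_mem sE => -[].
- by case=> <-; exact: s_head sE.
- move=> [X0 uX]; have [Y0 uY] := s_head _ _ sE.
  by congr Some; apply: le_anti; [exact: uX | exact: uY].
Qed.

Lemma lm_coef f X : lm P le f = Some X -> coef P f X != 0.
Proof. by case/lmP. Qed.

Lemma lm_upto f X : lm P le f = Some X -> upto X f.
Proof. by case/lmP. Qed.

Lemma lm_lc f X : lm P le f = Some X -> lc P le f = coef P f X.
Proof. by rewrite /lc => ->. Qed.

Lemma lm_lexp f X : lm P le f = Some X -> lexp P le f = X.1.
Proof. by rewrite /lexp => ->. Qed.

Lemma lm_neq0 f : f != 0 -> exists X, lm P le f = Some X.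
Proof.
case fE: (lm P le f) => [X|]; first by exists X.
move=> /negP[]; apply/eqP; apply: coef_inj => X; apply/eqP; apply/negPn.
rewrite -mem_monomials -(mem_sort (fun X Y => le Y X)).
by move: fE; rewrite /lm; case: sort.
Qed.

Lemma symbol_coord_neq0 u c (a : A) v :
  symbol P u c a -> (coord P a)@_v != 0 -> v = u \/ (mdeg v < mdeg u)%N.
Proof.
move=> sa v0; have [->|vu] := eqVneq v u; [by left | right].
apply: (deg_lt_coord_neq0 sa); rewrite raddfB mcoeffB coord_cst_xmon.
by rewrite [u == v]eq_sym (negPf vu) subr0.
Qed.

(** A monomial order refines the degree, so congruence modulo lower degree is
enough to control monomials. *)
Lemma symbol_le X u c (a : A) v :
  symbol P u c a -> (coord P a)@_v != 0 -> le (shift X v) (shift X u).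
Proof.
move=> sa /(symbol_coord_neq0 sa)[->|vu]; first exact: le_refl.
by apply: ltmW; apply: ltm_deg; rewrite /= !mdegD ltn_add2l.
Qed.

Lemma coef_rscale f (h : A) X : coef P (rscale f h) X =
  \sum_(w <- msupp (coord P (f X.2)))
     (coord P (emb P (coef P f (w, X.2)) * xmon P w * h))@_X.1.
Proof.
by rewrite /coef ffunE [in LHS](pbw_expand P (f X.2)) mulr_suml !raddf_sum.
Qed.

Lemma upto_rscale X f u c (a : A) : upto X f -> symbol P u c a ->
  upto (shift X u) (rscale f a).
Proof.
move=> uf sa Y; rewrite coef_rscale => Y0.
have [w wf w0] : exists2 w, w \in msupp (coord P (f Y.2)) &
    (coord P (emb P (coef P f (w, Y.2)) * xmon P w * a))@_Y.1 != 0.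
  apply/hasP; apply: contraNT Y0 => /hasPn w0; apply/eqP.
  by apply: big1_seq => w /andP[_ /w0]; rewrite negbK => /eqP.
have wX : le (w, Y.2) X by apply: uf; rewrite -mcoeff_msupp.
apply: le_trans (le_shift u wX).
have := symbol_le (0%MM, Y.2) (symbolM (symbol_term P w _) sa) w0.
by rewrite /shift /= !add0m -surjective_pairing.
Qed.

(** Right multiplication by a polynomial with leading exponent u shifts all
monomials of f by u, up to lower terms, and the shift is strictly increasing;
hence only the term of f at X reaches [shift X u]. *)
Lemma coef_rscale_shift X f u c (a : A) : upto X f -> symbol P u c a ->
  coef P (rscale f a) (shift X u)
  = coef P f X * sigma_exp P X.1 c * cmon P X.1 u.
Proof.
move=> uf sa; rewrite coef_rscale /=.
have term w : symbol P (w + u)%MM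
    (coef P f (w, X.2) * sigma_exp P w c * cmon P w u)
    (emb P (coef P f (w, X.2)) * xmon P w * a) by exact: symbolM (symbol_term _ _ _) sa.
have other w : w \in msupp (coord P (f X.2)) -> w != X.1 ->
    (coord P (emb P (coef P f (w, X.2)) * xmon P w * a))@_(X.1 + u) = 0.
  rewrite mcoeff_msupp => /(uf (w, X.2)) /(le_shift u) wX nwX.
  apply/eqP; apply: contraNT nwX => /(symbol_le (0%MM, X.2) (term w)).
  by rewrite /shift /= !add0m => /(le_anti wX) /(congr1 fst) /addIm /= ->.
rewrite -(symbol_coord (term X.1)) -surjective_pairing.
have [X0|X0] := boolP (X.1 \in msupp (coord P (f X.2))).
  rewrite (bigD1_seq X.1) ?msupp_uniq //= -surjective_pairing.
  by rewrite big1_seq ?addr0 // => w /andP[nwX /other]; apply.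
rewrite [in RHS]/coef (memN_msupp_eq0 X0) rmorph0 !mul0r raddf0 mcoeff0.
by apply: big1_seq => w /andP[_ wf]; apply: other => //; apply: contraNneq X0 => <-.
Qed.

(** The condition on leading coefficients in a reduction step says exactly that
the coefficient of X cancels. *)
Lemma reduces1_below G f h X :
  lm P le f = Some X -> reduces1 P le G f h -> below X h.
Proof.
move=> fX [[f0 _]|]; first by move: (lm_coef fX); rewrite f0 coef0 eqxx.
case=> Y []; rewrite fX => -[<-] {Y} [t [fs [r [b [a [fsP lcE ->]]]]]].
have sh k : shift (b k, X.2) (a k) = X.
  by have [_ _ E] := fsP k; rewrite /shift /= E -surjective_pairing.
have fs_upto k : upto X (rscale (fs k) (emb P (r k) * xmon P (a k))).
  rewrite -(sh k); apply: upto_rscale (symbol_term P _ _).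
  by have [_ /lm_upto] := fsP k.
apply: upto_below; first by apply: uptoB; [exact: lm_upto | exact: upto_sum].
rewrite coefB coef_sum -(lm_lc fX) lcE -sumrB big1 // => k _.
have [_ fk _] := fsP k; rewrite -(sh k).
by rewrite (coef_rscale_shift (lm_upto fk) (symbol_term P _ _)) (lm_lc fk) subrr.
Qed.
End LeadingMonomials.

(** * Representations by elements of G *)

Section Lcm.
Context (n m : nat).
Implicit Types (s : seq (monomial n m)) (W X Y : monomial n m).

Lemma mlcms_dvd s W Y :
  mlcms s = Some W -> Y \in s -> Y.2 = W.2 /\ (Y.1 <= W.1)%MM.
Proof.
case: s => // X s; rewrite /mlcms; case: ifP => // /allP sX [<-] Ys /=; split.
  by move: Ys; rewrite inE => /predU1P[->//|/sX/eqP].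
elim: (X :: s) Ys => // Z t IH; rewrite inE big_cons => /predU1P[->|/IH Yt].
  exact: lem_mlcml.
exact: lepm_trans Yt (lem_mlcmr _ _).
Qed.

Lemma mlcms_common s X :
  s != [::] -> (forall Y, Y \in s -> Y.2 = X.2 /\ (Y.1 <= X.1)%MM) ->
  exists W, [/\ mlcms s = Some W, W.2 = X.2 & (W.1 <= X.1)%MM].
Proof.
case: s => // Z s _ sX; have [ZX _] := sX Z (mem_head _ _).
exists (\big[@mlcm n/0%MM]_(Y <- Z :: s) Y.1, Z.2); split=> //.
  rewrite /mlcms ifT //; apply/allP => Y Ys.
  by rewrite ZX; apply/eqP; apply: (sX Y _).1; rewrite inE Ys orbT.
rewrite big_seq; elim/big_ind: _ => [|u v uX vX|Y /sX[]//].
  by apply/mnm_lepP => i; rewrite mnm0E.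
by rewrite lem_mlcm uX.
Qed.
End Lcm.

Section Representations.
Context (n : nat) (R A : nzRingType) (P : skewPBW n R A) (m : nat).
Context (le : rel (monomial n m)) (le_mo : monomial_order le).
Context (G : {fset {ffun 'I_m -> A}}).
Notation vec := {ffun 'I_m -> A}.
Notation mon := (monomial n m).
Notation ltm := (ltm le).
Implicit Types (f g h : vec) (X Y Z : mon) (u v w : 'X_{1..n}) (S T : mon -> Prop).

(** The level of a term g r x^u is the monomial lm(g) x^u. Cancellation may
make the leading monomial of a sum much smaller than the levels of its terms,
which is why levels are recorded with the sum. The predicate is inductive
rather than a choice of cofactors, so that closure properties and normal forms
follow by induction on the sum. *)
Inductive rep S : vec -> Prop :=
| rep0 : rep S 0
| repD f g : rep S f -> rep S g -> rep S (f + g)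
| rep_term g r u X : g \in G -> lm P le g = Some X -> S (shift X u) ->
    rep S (rscale g (emb P r * xmon P u)).

Lemma rep_sub S T f : (forall X, S X -> T X) -> rep S f -> rep T f.
Proof.
move=> ST; elim=> [|f1 f2 _ r1 _ r2|g r u X gG gX SX]; first exact: rep0.
  exact: repD.
by apply: rep_term gX _ => //; exact: ST.
Qed.

Lemma rep_sum S (J : eqType) (s : seq J) (F : J -> vec) :
  (forall j, j \in s -> rep S (F j)) -> rep S (\sum_(j <- s) F j).
Proof.
move=> rF; rewrite big_seq; elim/big_rec: _ => [|j f js rf]; first exact: rep0.
by apply: repD => //; exact: rF.
Qed.

Lemma rep_rscale_gen S g X (a : A) : g \in G -> lm P le g = Some X ->
  (forall u, (coord P a)@_u != 0 -> S (shift X u)) -> rep S (rscale g a).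
Proof.
move=> gG gX Sa; rewrite (pbw_expand P a) rscale_sumr; apply: rep_sum => u ua.
by apply: rep_term gX _ => //; apply: Sa; rewrite -mcoeff_msupp.
Qed.

Lemma rep_below X f : rep (ltm^~ X) f -> below P le X f.
Proof.
elim=> [Y|f1 f2 _ b1 _ b2|g r u Y gG gY YX]; first by rewrite coef0 eqxx.
  exact: belowD.
move=> Z Z0; apply: le_lt_trans YX => //.
exact: (upto_rscale le_mo (lm_upto le_mo gY) (symbol_term P u r)) Z0.
Qed.

Lemma rep_rscale X f u c (a : A) : rep (ltm^~ X) f -> symbol P u c a ->
  rep (ltm^~ (shift X u)) (rscale f a).
Proof.
move=> rf sa; elim: rf => [|f1 f2 _ r1 _ r2|g r v Y gG gY YX].
- by rewrite rscale0l; exact: rep0.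
- by rewrite rscaleDl; exact: repD.
rewrite rscaleA; apply: rep_rscale_gen gY _ => // w.
move=> /(symbol_le le_mo Y (symbolM (symbol_term P v r) sa)) wY.
apply: (le_lt_trans le_mo wY).
by have := ltm_shift le_mo u YX; rewrite /shift /= addmA.
Qed.

(** A finite sum of terms has a term of largest level, from which the
well-founded induction starts. *)
Lemma rep_max S f : rep S f -> f = 0 \/ exists2 X, S X & rep (le^~ X) f.
Proof.
elim=> [|f1 f2 _ r1 _ r2|g r u X gG gX SX]; first by left.
  case: r1 => [->|[X1 S1 r1]]; first by rewrite add0r.
  case: r2 => [->|[X2 S2 r2]]; first by right; rewrite addr0; exists X1.
  right; have [le12|le21] : le X1 X2 \/ le X2 X1.
    by apply/orP; case: le_mo => -[_ _ _ t] _ _ _; exact: t.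
  - exists X2 => //; apply: repD => //; apply: rep_sub r1 => Y YX.
    exact: le_trans YX le12.
  - exists X1 => //; apply: repD => //; apply: rep_sub r2 => Y YX.
    exact: le_trans YX le21.
right; exists (shift X u) => //; apply: rep_term gX _ => //; exact: le_refl.
Qed.

(** The subset of G to which the hypothesis on S-vectors is applied. It may
contain vectors with coefficient 0 at level X, so that it does not depend on the
vector being represented. *)
Definition lm_divisors X : {fset vec} :=
  [fset g in G | if lm P le g is Some Y then (Y.2 == X.2) && (Y.1 <= X.1)%MM
                 else false].

Lemma lm_divisorsP X g : g \in lm_divisors X ->
  g \in G /\ exists Y, [/\ lm P le g = Some Y, Y.2 = X.2 & (Y.1 <= X.1)%MM].
Proof.
rewrite !inE /= => /andP[gG]; case gY: (lm P le g) => [Y|] // /andP[/eqP Y2 Y1].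
by split=> //; exists Y.
Qed.

Lemma lm_divisors_shift X g : g \in lm_divisors X -> exists Y,
  [/\ lm P le g = Some Y, lexp P le g = Y.1 & shift Y (gamma_ P le X.1 g) = X].
Proof.
case/lm_divisorsP => _ [Y [gY Y2 Y1]]; exists Y; split=> //; first exact: lm_lexp.
rewrite /shift /gamma_ (lm_lexp gY) addmC submK // Y2.
by rewrite -surjective_pairing.
Qed.

Definition top_part X (r : vec -> R) : vec :=
  \sum_(g : lm_divisors X)
     rscale (val g) (emb P (r (val g)) * xmon P (gamma_ P le X.1 (val g))).

(** The terms of level exactly X can be collected, since x^u is determined by
g and X: this leaves one coefficient r(g) for each g. *)
Lemma rep_top X f : rep (le^~ X) f ->
  exists r, rep (ltm^~ X) (f - top_part X r).
Proof.
elim=> [|f1 f2 _ [r1 h1] _ [r2 h2]|g r u Y gG gY /le_eqVlt[XE|YX]].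
- exists (fun=> 0); rewrite /top_part big1 ?subrr; first exact: rep0.
  by move=> g _; rewrite rmorph0 mul0r rscale0r.
- exists (fun g => r1 g + r2 g).
  suff -> : top_part X (fun g => r1 g + r2 g) = top_part X r1 + top_part X r2.
    by rewrite opprD addrACA; exact: repD.
  by rewrite -big_split; apply: eq_bigr => g _ /=; rewrite rmorphD mulrDl rscaleDr.
- have gD : g \in lm_divisors X.
    by rewrite !inE /= gG gY -XE /= eqxx lem_addr.
  exists (fun h => if h == g then r else 0).
  rewrite /top_part (bigD1 [` gD]) //= eqxx big1 ?addr0; last first.
    move=> h; rewrite -val_eqE /= => /negPf ->.
    by rewrite rmorph0 mul0r rscale0r.
  have -> : gamma_ P le X.1 g = u by rewrite /gamma_ (lm_lexp gY) -XE /= addmC addmK.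
  by rewrite subrr; exact: rep0.
exists (fun=> 0); rewrite /top_part big1 ?subr0; first exact: rep_term gY YX.
by move=> h _; rewrite rmorph0 mul0r rscale0r.
Qed.

Definition top_coef X (r : vec -> R) : R :=
  \sum_(g : lm_divisors X) lc P le (val g) * sigma_exp P (lexp P le (val g)) (r (val g))
                        * cmon P (lexp P le (val g)) (gamma_ P le X.1 (val g)).

Lemma top_part_upto X r : upto P le X (top_part X r).
Proof.
apply: upto_sum => g; have [Y [gY _ YX]] := lm_divisors_shift (valP g).
have := upto_rscale le_mo (lm_upto le_mo gY)
  (symbol_term P (gamma_ P le X.1 (val g)) (r (val g))).
by rewrite YX.
Qed.

Lemma coef_top_part X r : coef P (top_part X r) X = top_coef X r.
Proof.
rewrite coef_sum; apply: eq_bigr => g _.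
have [Y [gY gexp YX]] := lm_divisors_shift (valP g).
have := coef_rscale_shift le_mo (lm_upto le_mo gY)
  (symbol_term P (gamma_ P le X.1 (val g)) (r (val g))).
by rewrite YX gexp (lm_lc gY).
Qed.

(** The terms of level X are a one-step reduction of f as soon as their leading
coefficients do not cancel. *)
Lemma reducible_top X f r : rep (ltm^~ X) (f - top_part X r) -> top_coef X r != 0 ->
  reducible P le G f.
Proof.
move=> hr c0; have low := rep_below hr.
have fE : coef P f X = top_coef X r.
  rewrite -coef_top_part; apply/eqP; rewrite -subr_eq0 -coefB.
  by apply: contraNT (ltm_irr le X) => /low.
have fX : lm P le f = Some X.
  apply/lmP => //; rewrite fE; split=> // Z.
  rewrite -[f](subrK (top_part X r)) coefD.
  have [->|/low/ltmW//] := eqVneq (coef P (f - top_part X r) Z) 0.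
  by rewrite add0r => /(top_part_upto).
split=> [f0|]; first by move: c0; rewrite -fE f0 coef0 eqxx.
exists (f - top_part X r); right; exists X; split=> //.
exists #|{: lm_divisors X}|, (fun k => val (enum_val k)), (fun k => r (val (enum_val k))),
  (fun k => lexp P le (val (enum_val k))), (fun k => gamma_ P le X.1 (val (enum_val k))).
split.
- move=> k; set g := enum_val k; have [gG _] := lm_divisorsP (valP g).
  have [Y [gY gexp YX]] := lm_divisors_shift (valP g).
  have [Y1 Y2] := (congr1 fst YX : _ = _, congr1 snd YX : Y.2 = X.2).
  by rewrite gY gexp -Y2 -surjective_pairing; split=> //; exact: Y1.
- by rewrite (lm_lc fX) fE /top_coef (reindex _ (onW_bij _ (@enum_val_bij _))).
- by congr (_ - _); rewrite /top_part (reindex _ (onW_bij _ (@enum_val_bij _))).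
Qed.

Lemma reduces1_rep W f h : reduces1 P le G f h -> below P le W f ->
  rep (ltm^~ W) (f - h).
Proof.
case=> [[-> ->]|[X [fX [t [fs [r [b [a [fsP _ ->]]]]]]]] fW].
  by rewrite subrr => _; exact: rep0.
rewrite opprB addrC subrK; apply: rep_sum => k _; have [fsG fsX E] := fsP k.
apply: rep_term fsX _ => //; rewrite /shift /= E -surjective_pairing.
by apply: fW; exact: lm_coef fX.
Qed.

(** The vectors subtracted along a chain of reductions are terms of level at
most the current leading monomial, and all of them remain below W. *)
Lemma reduces_rep W f h : reduces P le G f h -> below P le W f ->
  rep (ltm^~ W) (f - h).
Proof.
elim=> [f1 h1|f1 f2 f3 _ IH1 _ IH2 b1]; first exact: reduces1_rep.
have r12 := IH1 b1; rewrite -(subrKA f2); apply: repD => //; apply: IH2.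
by rewrite -[f2](subKr f1); apply: belowB => //; exact: rep_below.
Qed.
End Representations.

(** * S-vectors and the criterion *)

Section SVectors.
Context (n : nat) (R A : nzRingType) (P : skewPBW n R A) (bijP : bijective_PBW P).
Context (m : nat) (le : rel (monomial n m)) (le_mo : monomial_order le).
Notation vec := {ffun 'I_m -> A}.
Notation mon := (monomial n m).
Notation ltm := (ltm le).
Implicit Types (F G : {fset vec}) (g : vec) (W X Y : mon).

(** The combination that generalizes the S-polynomial of a pair. *)
Definition svector F W (b : {ffun F -> R}) : vec :=
  \sum_(g : F) rscale (val g)
    (emb P (psi_inv bijP (lexp P le (val g)) (gamma_ P le W.1 (val g)) (b g))
     * xmon P (gamma_ P le W.1 (val g))).

Lemma X_shift F W g : X_ P le F = Some W -> g \in F -> g != 0 -> exists Y,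
  [/\ lm P le g = Some Y, lexp P le g = Y.1 & shift Y (gamma_ P le W.1 g) = W].
Proof.
move=> FW gF /(lm_neq0 P le)[Y gY]; exists Y; split=> //; first exact: lm_lexp.
have [Y2 Y1] : Y.2 = W.2 /\ (Y.1 <= W.1)%MM.
  by apply: (mlcms_dvd FW); rewrite mem_pmap -gY map_f.
by rewrite /shift /gamma_ (lm_lexp gY) addmC submK // Y2 -surjective_pairing.
Qed.

(** By [sigma_cmon] the coefficient at W is the left-hand side of the syzygy
equation for b. *)
Lemma svector_below F W (b : {ffun F -> R}) :
  X_ P le F = Some W -> (forall g, g \in F -> g != 0) ->
  syz (lead_row P le F W.1) b -> below P le W (svector W b).
Proof.
move=> FW F0 syz_b.
have gP (g : F) := X_shift FW (valP g) (F0 _ (valP g)).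
apply: upto_below.
  apply: upto_sum => g; have [Y [gY _ YW]] := gP g.
  have := upto_rscale le_mo (lm_upto le_mo gY) (symbol_term P
    (gamma_ P le W.1 (val g))
    (psi_inv bijP (lexp P le (val g)) (gamma_ P le W.1 (val g)) (b g))).
  by rewrite YW.
rewrite coef_sum -[RHS]syz_b; apply: eq_bigr => g _; have [Y [gY gexp YW]] := gP g.
have := coef_rscale_shift le_mo (lm_upto le_mo gY) (symbol_term P
    (gamma_ P le W.1 (val g))
    (psi_inv bijP (lexp P le (val g)) (gamma_ P le W.1 (val g)) (b g))).
rewrite YW => ->; rewrite ffunE (lm_lc gY) gexp -mulrA sigma_cmon.
by rewrite psi_invK mulrA.
Qed.

(** Cancellation at level X is a consequence of cancellation at the lcm: the
leading coefficients form, after division by structure constants and a twist by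
psi, a syzygy generated by B, so that the terms of level X are a combination of
shifted S-vectors up to lower terms. *)
Lemma rep_top_part (B : forall F, {fset {ffun F -> R}}) (hB : syz_generators P le B)
    G (hG0 : forall g, g \in G -> g != 0) X (r : vec -> R) :
  (forall F W, F `<=` G -> F != fset0 -> X_ P le F = Some W ->
     forall b, b \in B F -> reduces P le G (svector W b) 0) ->
  top_coef P le G X r = 0 -> rep P le G (ltm^~ X) (top_part P le G X r).
Proof.
move=> S_red top0; set D := lm_divisors P le G X.
have gD (g : D) : val g \in G by have [] := lm_divisorsP (valP g).
have DG : D `<=` G by apply/fsubsetP => g /lm_divisorsP[].
have D_neq0 g : g \in D -> g != 0 by case/lm_divisorsP => /hG0.
have [D0|Dn0] := eqVneq D fset0.
  rewrite /top_part big1 => [|g _]; first exact: rep0.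
  by have : val g \in D := valP g; move: (val g) => h; rewrite D0.
have [W [DW W2 WX]] : exists W, [/\ X_ P le D = Some W, W.2 = X.2 & (W.1 <= X.1)%MM].
  apply: mlcms_common => [|Y].
    have [g gD'] := fset0Pn _ Dn0.
    have [_ [Y [gY _ _]]] := lm_divisorsP gD'.
    apply/eqP => s0; have : Y \in pmap (lm P le) (enum_fset D).
      by rewrite mem_pmap -gY map_f.
    by rewrite s0.
  rewrite mem_pmap => /mapP[g /lm_divisorsP[_ [Z [-> Z2 Z1]]] [->]] //.
pose theta := (X.1 - W.1)%MM.
have WtX : shift W theta = X.
  by rewrite /shift /theta addmC submK // W2 -surjective_pairing.
pose beta (g : D) := lexp P le (val g).
pose gam (g : D) := gamma_ P le W.1 (val g).
have gP (g : D) : exists Y,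
    [/\ lm P le (val g) = Some Y, beta g = Y.1 & shift Y (gam g) = W].
  exact: X_shift DW (valP g) (D_neq0 _ (valP g)).
have bgW (g : D) : (beta g + gam g)%MM = W.1.
  by have [Y [_ -> <-]] := gP g.
have gamX (g : D) : gamma_ P le X.1 (val g) = (gam g + theta)%MM.
  apply: (@addmI _ (beta g)); rewrite addmA bgW.
  have [Y [_ gexp YX]] := lm_divisors_shift (valP g).
  have E1 : (Y.1 + gamma_ P le X.1 (val g))%MM = X.1 := congr1 fst YX.
  have E2 : (W.1 + theta)%MM = X.1 := congr1 fst WtX.
  by rewrite [beta g]gexp E1 E2.
have u_ex (g : D) : exists v, r (val g) = v * cmon P (gam g) theta.
  have [d [_ dc]] := invertible_cmon bijP (gam g) theta.
  by exists (r (val g) * d); rewrite -mulrA dc mulr1.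
(* u absorbs the constant c_{gamma, theta}; by [cmonA] this replaces
   c_{beta, gamma + theta} by c_{beta, gamma} and a factor depending on X only. *)
have [u ru] := fin_all_exists u_ex.
have syz_u : syz (lead_row P le D W.1) [ffun g => psi bijP (beta g) (gam g) (u g)].
  apply: (@cmon_rreg _ _ _ _ bijP W.1 theta); rewrite mul0r mulr_suml -[RHS]top0.
  apply: eq_bigr => g _; rewrite !ffunE -/(beta g) -/(gam g) gamX ru.
  rewrite -!mulrA -{1}(bgW g) sigma_expM -!mulrA -cmonA.
  by rewrite !mulrA -(mulrA _ (cmon P _ _) (psi _ _ _ _)) -sigma_cmon mulrA.
have [a ua] := (hB _ _ Dn0 D_neq0 DW _).1 syz_u.
have [t _ tK] := sigma_exp_bij bijP W.1.
(* psi^{-1}(a_b) = sigma^gamma(t(a_b)), where t(a_b) does not depend on g. *)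
have uE (g : D) : u g = \sum_(b <- enum_fset (B D))
    psi_inv bijP (beta g) (gam g) (b g) * sigma_exp P (gam g) (t (a b)).
  apply: (can_inj (psiK bijP (beta g) (gam g))); rewrite psi_sum.
  have := congr1 (fun f : {ffun D -> R} => f g) ua; rewrite ffunE sum_ffunE => ->.
  by apply: eq_bigr => b _; rewrite ffunE psiM psi_invK psi_sigma bgW tK.
pose tail b : A := emb P (t (a b)) * xmon P theta.
pose head (g : D) (b : {ffun D -> R}) : A :=
  emb P (psi_inv bijP (beta g) (gam g) (b g)) * xmon P (gam g).
(* The part of lower degree lost when psi^{-1}(a_b) is moved across x^gamma and
   x^gamma x^theta is replaced by x^(gamma + theta). *)
pose Q (g : D) := emb P (r (val g)) * xmon P (gam g + theta)%MM
  - \sum_(b <- enum_fset (B D)) head g b * tail b.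
have Q_symbol (g : D) : symbol P (gam g + theta)%MM 0 (Q g).
  have <- : r (val g) - \sum_(b <- enum_fset (B D))
      psi_inv bijP (beta g) (gam g) (b g) * sigma_exp P (gam g) (t (a b))
        * cmon P (gam g) theta = 0 by rewrite -mulr_suml -uE -ru subrr.
  apply: symbolB (symbol_term _ _ _) _; apply: symbol_sum => b.
  exact: symbolM (symbol_term _ _ _) (symbol_term _ _ _).
have -> : top_part P le G X r = \sum_(g : D) rscale (val g) (Q g)
    + \sum_(b <- enum_fset (B D)) rscale (svector W b) (tail b).
  under [X in _ + X]eq_bigr => b _ do rewrite rscale_suml.
  rewrite exchange_big -big_split; apply: eq_bigr => g _ /=.
  under eq_bigr => b _ do rewrite rscaleA.
  by rewrite -rscale_sumr -rscaleDr subrK gamX.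
apply: repD; apply: rep_sum.
  move=> g _; have [Y [gY _ YW]] := gP g.
  apply: rep_rscale_gen (gD g) gY _ => v v0; rewrite -WtX -YW.
  apply: (ltm_deg le_mo); rewrite /= !mdegD -addnA ltn_add2l -mdegD.
  apply: deg_lt_coord_neq0 v0.
  by have := Q_symbol g; rewrite /symbol raddf0 mul0r subr0.
move=> b bB; rewrite -WtX; apply: (rep_rscale le_mo _ (symbol_term P _ _)).
rewrite -[svector W b]subr0; apply: reduces_rep (S_red _ _ DG Dn0 DW b bB) _ => //.
apply: svector_below => //; exact: generates_sub (hB _ _ Dn0 D_neq0 DW) bB.
Qed.
End SVectors.

Theorem theorem5p4 (R A : nzRingType) (n : nat) (rgs : RGS R)
    (P : skewPBW n R A) (bijP : bijective_PBW P)
    (m : nat) (m_gt0 : (0 < m)%N)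
    (le : rel (monomial n m)) (le_mo : monomial_order le)
    (B : forall F : {fset {ffun 'I_m -> A}}, {fset {ffun F -> R}})
    (hB : syz_generators P le B)
    (M : {ffun 'I_m -> A} -> Prop) (hM : right_submodule M)
    (hM0 : exists f, M f /\ f != 0)
    (G : {fset {ffun 'I_m -> A}}) (hG0 : forall g, g \in G -> g != 0)
    (hG : generates G M) :
  groebner_basis P le M G
  <->
  (forall (F : {fset {ffun 'I_m -> A}}) (X : monomial n m),
     F `<=` G -> F != fset0 -> X_ P le F = Some X ->
     forall b : {ffun F -> R}, b \in B F ->
       reduces P le G
         (\sum_(g : F)
            rscale (val g)
              (emb P (psi_inv bijP (lexp P le (val g)) (gamma_ P le X.1 (val g)) (b g))
               * xmon P (gamma_ P le X.1 (val g))))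
         0).
Proof.
have GM g : g \in G -> M g by exact: generates_sub.
split.
- case=> _ _ red_M F X FG _ _ b _; set f := \sum_(g : F) _.
  have Mf : M f.
    apply: right_submodule_sum => // g; case: hM => _ _; apply.
    by apply: GM; apply: (fsubsetP FG); exact: valP.
  have step0 : reduces P le G 0 0 by apply: t_step; left.
  (* Every element of M reduces to 0, by induction on its leading monomial. *)
  have red Y : forall h, lm P le h = Some Y -> M h -> reduces P le G h 0.
    elim/(well_founded_ind (ltm_wf le_mo)): Y => Y IH h hY Mh.
    have h0 : h != 0.
      by apply: contraNneq (lm_coef le_mo hY) => ->; rewrite coef0.
    have [_ [k hk]] := red_M h Mh h0.
    have low := reduces1_below le_mo hY hk.
    have Mk : M k.
      case: hk => [[_ ->]|[Z [_ [t [fs [r [be [al [fsP _ ->]]]]]]]]].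
        by case: hM.
      apply: right_submoduleB => //; apply: right_submodule_sum => // i.
      by have [fG _ _] := fsP i; case: hM => _ _; apply; exact: GM.
    have [k0|/(lm_neq0 P le)[Z kZ]] := eqVneq k 0.
      by rewrite k0 in hk; exact: t_step.
    apply: t_trans (t_step _ _ _ _ hk) _; apply: (IH Z) => //.
    by apply: low; exact: lm_coef kZ.
  have [->//|/(lm_neq0 P le)[Y fY]] := eqVneq f 0.
  exact: red fY Mf.
move=> S_red; split.
- case: hM0 => f [/hG [a ->]]; apply: contraNneq => ->.
  by rewrite big_seq_fset0.
- by move=> g gG; split; [exact: GM | exact: hG0].
have main X : forall f, rep P le G (le^~ X) f -> f != 0 -> reducible P le G f.
  elim/(well_founded_ind (ltm_wf le_mo)): X => X IH f fX f0.
  have [r fr] := rep_top fX.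
  have [c0|] := eqVneq (top_coef P le G X r) 0; last exact: (reducible_top le_mo fr).
  have : rep P le G ((ltm le)^~ X) f.
    rewrite -[f](subrK (top_part P le G X r)); apply: repD fr _.
    exact: (rep_top_part le_mo hB hG0 S_red c0).
  by case/(rep_max le_mo) => [fE|[Y YX /IH]]; [rewrite fE eqxx in f0 | apply].
move=> f /hG[a ->] f0.
have : rep P le G (fun=> True) (\sum_(g <- enum_fset G) rscale g (a g)).
  apply: rep_sum => g gG; have [Y gY] := lm_neq0 P le (hG0 g gG).
  exact: rep_rscale_gen gY _.
by case/(rep_max le_mo) => [fE|[X _ /main]]; [rewrite fE eqxx in f0 | apply].
Qed.
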